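(* For an integer $q\ge 1$ let $A,B,C$ be complex vector spaces of dimension $q+1$ with bases $a_0,\dots,a_q$, $b_0,\dots,b_q$, $c_0,\dots,c_q$, and let $$T_{cw,q}=\sum_{j=1}^q \left(a_0\otimes b_j\otimes c_j+a_j\otimes b_0\otimes c_j+a_j\otimes b_j\otimes c_0\right)\in A\otimes B\otimes C.$$ Then for all $q>4$, $\underline{\mathbf{R}}(T_{cw,q}^{\boxtimes 3})=(q+2)^3$.
   Context: A tensor has rank one if it is of the form $a\otimes b\otimes c$. The border rank $\underline{\mathbf{R}}(T)$ of a tensor $T$ is the smallest $r$ such that $T$ is a limit of a sequence of sums of $r$ rank one tensors. For $T\in A\otimes B\otimes C$ and $T'\in A'\otimes B'\otimes C'$, the Kronecker product $T\boxtimes T'$ is $T\otimes T'$ regarded as a 3-way tensor in $(A\otimes A')\otimes(B\otimes B')\otimes(C\otimes C')$; $T^{\boxtimes N}$ denotes the $N$-fold Kronecker power. *)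

(* Defs.v *)
From mathcomp Require Import all_boot all_order all_algebra.
From mathcomp Require Import complex.
From mathcomp Require Import boolp classical_sets reals topology normedtype.

Set Implicit Arguments.
Unset Strict Implicit.
Unset Printing Implicit Defensive.

Import GRing.Theory.
Import numFieldNormedType.Exports.
Local Open Scope ring_scope.
Local Open Scope classical_set_scope.
Local Open Scope complex_scope.

(* Vectors and three-way tensors are written in coordinates with respect to
   fixed bases indexed by finite types I, J, K, so that
   C^I (x) C^J (x) C^K is the space of arrays indexed by I * J * K. *)
Definition vec (R : realType) (I : finType) := {ffun I -> R[i]}.

Definition tensor (R : realType) (I J K : finType) := {ffun I * J * K -> R[i]}.

Definition basis_vec (R : realType) (I : finType) (i : I) : vec R I :=
  [ffun i' => (i' == i)%:R].

Definition tens3 (R : realType) (I J K : finType)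
    (a : vec R I) (b : vec R J) (c : vec R K) : tensor R I J K :=
  [ffun p => a p.1.1 * b p.1.2 * c p.2].

(* The zero tensor is of this form; excluding it would not change the border
   rank, since 0 is a limit of nonzero rank one tensors when I, J, K are
   nonempty. *)
Definition rank_one (R : realType) (I J K : finType) (T : tensor R I J K) :=
  exists a b c, T = tens3 a b c.

Definition sum_of_rank_ones (R : realType) (I J K : finType) (r : nat)
    (T : tensor R I J K) :=
  exists S : 'I_r -> tensor R I J K,
    (forall s, rank_one (S s)) /\ T = \sum_(s < r) S s.

(* The tensor space is finite dimensional, so convergence in it is
   convergence of every coordinate in R[i]. *)
Definition tensor_cvg (R : realType) (I J K : finType)
    (u : nat -> tensor R I J K) (T : tensor R I J K) :=
  forall p, (fun n => u n p : R[i]^o) @ \oo --> (T p : R[i]^o).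

Definition limit_of_rank_sums (R : realType) (I J K : finType)
    (T : tensor R I J K) (r : nat) :=
  exists u : nat -> tensor R I J K,
    (forall n, sum_of_rank_ones r (u n)) /\ tensor_cvg u T.

Lemma limit_of_rank_sums_ex (R : realType) (I J K : finType)
    (T : tensor R I J K) :
  exists r, `[< limit_of_rank_sums T r >].
Proof.
exists #|{: I * J * K}|; apply/asboolP; exists (fun=> T); split; last first.
  by move=> p; apply: cvg_cst.
move=> _; pose S (p : I * J * K) : tensor R I J K :=
  tens3 (T p *: basis_vec R p.1.1) (basis_vec R p.1.2) (basis_vec R p.2).
exists (fun s => S (enum_val s)); split; first by move=> s; do 3!eexists.
rewrite -(big_enum_val (A := {: I * J * K}) S) /=.
apply/ffunP => -[[i j] k]; rewrite sum_ffunE (bigD1 (i, j, k)) //= big1.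
  by rewrite !ffunE /= !eqxx !mulr1 addr0 /GRing.scale /= mulr1.
move=> [[i' j'] k'] /= ne; rewrite !ffunE /= /GRing.scale /=.
case: (eqVneq i i') ne => [<-|_ _]; last by rewrite mulr0 !mul0r.
case: (eqVneq j j') => [<-|_ _]; last by rewrite mulr0 mul0r.
by case: (eqVneq k k') => [<-|_ _]; rewrite ?eqxx // mulr0.
Qed.

Definition border_rank (R : realType) (I J K : finType)
    (T : tensor R I J K) : nat :=
  ex_minn (limit_of_rank_sums_ex T).

(* Coordinates on (A (x) A') (x) (B (x) B') (x) (C (x) C') are indexed by
   (I * I') * (J * J') * (K * K'). *)
Definition kron (R : realType) (I J K I' J' K' : finType)
    (T : tensor R I J K) (T' : tensor R I' J' K') :
    tensor R (I * I')%type (J * J')%type (K * K')%type :=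
  [ffun p => T (p.1.1.1, p.1.2.1, p.2.1) * T' (p.1.1.2, p.1.2.2, p.2.2)].

Fixpoint idx_pow (I : finType) (N : nat) : finType :=
  if N is N'.+1 then (I * idx_pow I N')%type else unit.

(* T^{N} = T [x] (T [x] (... [x] 1)), where the 0-th power is the scalar 1 as a
   tensor over one-dimensional spaces. *)
Fixpoint kron_pow (R : realType) (I J K : finType) (T : tensor R I J K)
    (N : nat) : tensor R (idx_pow I N) (idx_pow J N) (idx_pow K N) :=
  if N is N'.+1 then kron T (kron_pow T N') else [ffun=> 1].

Definition T_cw (R : realType) (q : nat) :
    tensor R 'I_q.+1 'I_q.+1 'I_q.+1 :=
  let e := @basis_vec R 'I_q.+1 in
  \sum_(j < q.+1 | j != ord0)
    (tens3 (e ord0) (e j) (e j) + tens3 (e j) (e ord0) (e j)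
     + tens3 (e j) (e j) (e ord0)).

(* Main.v *)
Require Import Defs.
From Stdlib Require Import BinPos BinNat BinInt.
From Stdlib Require FMapPositive.
From HB Require Import structures.
From mathcomp Require Import all_boot all_order all_algebra.
From mathcomp Require Import complex reals.
From mathcomp Require Import boolp classical_sets topology normedtype sequences.
From mathcomp Require Import ssrZ zify ring.

(* Upper bound: T_cw is a limit of sums of q+2 rank one tensors (Coppersmith and
   Winograd), and border rank is submultiplicative under Kronecker products.

   Lower bound: compose T = T_cw^{3} with a linear map A^{(x)3} -> C^5 and with
   e_s |-> e_s /\ _ : Lambda^2 C^5 -> Lambda^3 C^5. This Koszul flattening has
   rank at most 6 on rank one tensors, so 6 * border rank bounds its rank on T.
   The map A^{(x)3} -> C^5 is chosen to vanish on all monomials with an index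
   above 5. The flattening of T is then block diagonal: a block is given by the
   set of factors whose b-index exceeds 5, together with these indices, and its
   entries do not depend on q. There are only eight different blocks, and the one
   with k inner factors has rank 6 * 7^k. As the q-5 outer indices of a factor
   each count 1 against 7 for the inner ones, the ranks add up to
   6 * (7 + (q-5))^3 = 6 * (q+2)^3. *)

Set Implicit Arguments.
Unset Strict Implicit.
Unset Printing Implicit Defensive.

Import Order.TTheory GRing.Theory Num.Theory.
Import numFieldNormedType.Exports.
Local Open Scope ring_scope.
Local Open Scope complex_scope.

(** * Flattenings of a tensor twisted by a family of matrices *)

Section Flat.
Variables (R : realType) (I J K : finType) (n : nat).
Variable W : I -> 'M[R[i]]_n.

(** The matrix with block [\sum_i T (i, j, k) W_i] at (j, k); pairs are enumerated because matrices
    are indexed by ordinals. *)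
Definition flat (T : tensor R I J K) :
    'M[R[i]]_(#|{: J * 'I_n}|, #|{: K * 'I_n}|) :=
  \matrix_(x, y) \sum_i T (i, (enum_val x).1, (enum_val y).1) *
                        W i (enum_val x).2 (enum_val y).2.

Lemma flat_sum r (S : 'I_r -> tensor R I J K) :
  flat (\sum_(s < r) S s) = \sum_(s < r) flat (S s).
Proof.
apply/matrixP=> x y; rewrite !mxE summxE.
rewrite (eq_bigr (fun s => \sum_i S s (i, (enum_val x).1, (enum_val y).1) *
                        W i (enum_val x).2 (enum_val y).2)); last first.
  by move=> s _; rewrite mxE.
rewrite exchange_big; apply: eq_bigr => i _.
by rewrite sum_ffunE mulr_suml.
Qed.

(** On a (x) b (x) c the flattening is the Kronecker product of b c^T with M = sum_i a_i W_i, so a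
    rank factorization of M gives one of the same size for it. *)
Lemma flat_tens3 a b c :
  (\rank (flat (tens3 a b c)) <= \rank (\sum_i a i *: W i)%R)%N.
Proof.
set M := (\sum_i a i *: W i)%R.
pose B := \matrix_(x, t) (b (enum_val x).1 * col_base M (enum_val x).2 t)
  : 'M[R[i]]_(#|{: J * 'I_n}|, \rank M).
pose C := \matrix_(t, y) (c (enum_val y).1 * row_base M t (enum_val y).2)
  : 'M[R[i]]_(\rank M, #|{: K * 'I_n}|).
suff -> : flat (tens3 a b c) = B *m C by exact: mulmx_max_rank.
apply/matrixP=> x y; rewrite !mxE.
transitivity (b (enum_val x).1 * c (enum_val y).1 * M (enum_val x).2 (enum_val y).2).
  rewrite /M summxE mulr_sumr; apply: eq_bigr => i _.
  by rewrite !mxE ffunE /= [a i * _]mulrC -!mulrA; congr (_ * _); rewrite mulrCA.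
rewrite -{1}(mulmx_base M) mxE mulr_sumr; apply: eq_bigr => t _.
by rewrite !mxE mulrACA.
Qed.

Lemma flat_rank r rho T :
    (forall a : I -> R[i], (\rank (\sum_i a i *: W i)%R <= rho)%N) ->
  sum_of_rank_ones r T -> (\rank (flat T) <= rho * r)%N.
Proof.
move=> HW [S [S1 ->]]; rewrite flat_sum.
elim: r S S1 => [|r IHr] S S1; first by rewrite big_ord0 mxrank0.
rewrite big_ord_recr /= mulnS addnC; apply: leq_trans (mxrank_add _ _) _.
apply: leq_add; first by apply: IHr => s; apply: S1.
by have [a [b [c ->]]] := S1 ord_max; apply: leq_trans (flat_tens3 _ _ _) (HW _).
Qed.

End Flat.

(** * Semicontinuity of matrix rank under entrywise limits *)

Section Limits.
Local Open Scope classical_set_scope.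

Lemma cvg_prod_ord (R : realType) (n : nat) (u : 'I_n -> nat -> R[i]^o)
    (l : 'I_n -> R[i]^o) :
    (forall s, u s @ \oo --> l s) ->
  (fun k => \prod_(s < n) u s k : R[i]^o) @ \oo --> (\prod_(s < n) l s : R[i]^o).
Proof.
elim: n u l => [|n IHn] u l ul.
  rewrite big_ord0; under eq_fun do rewrite big_ord0; exact: cvg_cst.
rewrite big_ord_recl; under eq_fun do rewrite big_ord_recl.
by apply: cvgM => //; apply: IHn => s; apply: ul.
Qed.

Lemma cvg_sum_seq (R : realType) (T : Type) (r : seq T) (u : T -> nat -> R[i]^o)
    (l : T -> R[i]^o) :
    (forall s, u s @ \oo --> l s) ->
  (fun k => \sum_(s <- r) u s k : R[i]^o) @ \oo --> (\sum_(s <- r) l s : R[i]^o).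
Proof.
move=> ul; elim: r => [|s r IHr].
  rewrite big_nil; under eq_fun do rewrite big_nil; exact: cvg_cst.
rewrite big_cons; under eq_fun do rewrite big_cons.
exact: (cvgD (ul s) IHr).
Qed.

Definition mx_cvg (R : realType) m n (u : nat -> 'M[R[i]]_(m, n)) (M : 'M_(m, n)) :=
  forall x y, (fun k => u k x y : R[i]^o) @ \oo --> (M x y : R[i]^o).

Lemma mx_cvg_mul (R : realType) m n p (A : 'M[R[i]]_(m, n)) (u : nat -> 'M_(n, p)) M :
  mx_cvg u M -> mx_cvg (fun k => A *m u k) (A *m M).
Proof.
move=> uM x y; rewrite mxE; under eq_fun do rewrite mxE.
by apply: cvg_sum_seq => s; apply: cvgM; [exact: cvg_cst|exact: uM].
Qed.

Lemma mx_cvg_mulr (R : realType) m n p (A : 'M[R[i]]_(n, p)) (u : nat -> 'M_(m, n)) M :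
  mx_cvg u M -> mx_cvg (fun k => u k *m A) (M *m A).
Proof.
move=> uM x y; rewrite mxE; under eq_fun do rewrite mxE.
by apply: cvg_sum_seq => s; apply: cvgM; [exact: uM|exact: cvg_cst].
Qed.

Lemma mx_cvg_det (R : realType) n (u : nat -> 'M[R[i]]_n) M :
  mx_cvg u M -> (fun k => \det (u k) : R[i]^o) @ \oo --> (\det M : R[i]^o).
Proof.
move=> uM; rewrite /determinant; apply: cvg_sum_seq => s.
by apply: cvgM; [exact: cvg_cst | apply: cvg_prod_ord].
Qed.

(** If the limit had rank s > rho, fixed matrices on both sides would turn it into the identity of
    size s. The same products with [u k] are singular, so by continuity the determinant 1 would be a
    limit of zeros. *)
Lemma mx_cvg_rank (R : realType) m n rho (u : nat -> 'M[R[i]]_(m, n)) M :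
  mx_cvg u M -> (forall k, \rank (u k) <= rho)%N -> (\rank M <= rho)%N.
Proof.
move=> uM urho; rewrite leqNgt; apply/negP => rhoM.
(* [L^T] and [P] are one-sided inverses of the two factors in the rank factorization of [M]. *)
pose L := pinvmx (col_base M)^T; pose P := pinvmx (row_base M).
have LMP : L^T *m M *m P = 1%:M.
  have -> : L^T *m M = L^T *m (col_base M *m row_base M) by rewrite mulmx_base.
  rewrite mulmxA -mulmxA mulmxVp ?row_base_free // mulmx1.
  rewrite -[LHS]trmxK trmx_mul trmxK mulmxVp ?trmx1 //.
  by rewrite /row_free mxrank_tr; exact: col_base_full.
have det0 k : \det (L^T *m u k *m P) = 0.
  apply/eqP; apply: contraTT (rhoM) => det0; rewrite -leqNgt.
  have /mxrank_unit <- : L^T *m u k *m P \in unitmx by rewrite unitmxE unitfE.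
  apply: leq_trans (mxrankM_maxl _ _) _; apply: leq_trans (mxrankM_maxr _ _) _.
  exact: urho.
have := mx_cvg_det (@mx_cvg_mulr _ _ _ _ P _ _ (@mx_cvg_mul _ _ _ _ L^T _ _ uM)).
rewrite LMP det1; under eq_fun do rewrite det0.
move=> c1; have c0 : (fun _ : nat => 0 : R[i]^o) @ \oo --> (0 : R[i]^o) by exact: cvg_cst.
have e : (1 : R[i]^o) = 0.
  exact: (@cvg_unique R[i]^o (@norm_hausdorff _ R[i]^o) _ _ _ _ c1 c0).
by move/eqP: (oner_neq0 R[i]); apply.
Qed.

Lemma flat_limit (R : realType) (I J K : finType) n (W : I -> 'M[R[i]]_n)
    (T : tensor R I J K) r rho :
    (forall a : I -> R[i], (\rank (\sum_i a i *: W i)%R <= rho)%N) ->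
  limit_of_rank_sums T r -> (\rank (flat W T) <= rho * r)%N.
Proof.
move=> HW [u [ur uT]]; apply: (@mx_cvg_rank _ _ _ _ (fun k => flat W (u k))).
  move=> x y; rewrite mxE; under eq_fun do rewrite mxE.
  by apply: cvg_sum_seq => i; apply: cvgM; [exact: uT|exact: cvg_cst].
by move=> k; apply: flat_rank.
Qed.

End Limits.

(** * Closure properties of sums of rank one tensors *)

Section RankSums.
Variables (R : realType) (I J K : finType).
Implicit Types T U : tensor R I J K.

Lemma sum_of_rank_ones_fin (D : finType) (S : D -> tensor R I J K) :
  (forall d, rank_one (S d)) -> sum_of_rank_ones #|D| (\sum_d S d).
Proof.
move=> S1; exists (fun s => S (enum_val s)); split=> [s|]; first exact: S1.
by rewrite -(big_enum_val (A := {: D}) S).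
Qed.

Lemma sum_of_rank_ones1 T : rank_one T -> sum_of_rank_ones 1 T.
Proof. by move=> T1; exists (fun=> T); rewrite big_ord1. Qed.

Lemma sum_of_rank_onesD r s T U :
  sum_of_rank_ones r T -> sum_of_rank_ones s U -> sum_of_rank_ones (r + s) (T + U).
Proof.
move=> [S [S1 ->]] [S' [S1' ->]].
exists (fun x => match split x with inl a => S a | inr b => S' b end); split.
  by move=> x; case: (split x).
rewrite big_split_ord /=; congr (_ + _); apply: eq_bigr => x _.
  by rewrite (unsplitK (inl x)).
by rewrite (unsplitK (inr x)).
Qed.

End RankSums.

(** * Upper bound: submultiplicativity and the degeneration to [T_cw] *)

Section UpperBound.
Local Open Scope classical_set_scope.

Lemma kron_tens3 (R : realType) (I J K I' J' K' : finType)
    (a : vec R I) (b : vec R J) (c : vec R K) (a' : vec R I') (b' : vec R J') (c' : vec R K') :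
  kron (tens3 a b c) (tens3 a' b' c') =
  tens3 [ffun i => a i.1 * a' i.2] [ffun j => b j.1 * b' j.2] [ffun k => c k.1 * c' k.2].
Proof. by apply/ffunP=> p; rewrite !ffunE /= [LHS]mulrACA [X in X * _]mulrACA. Qed.

Lemma sum_of_rank_ones_kron (R : realType) (I J K I' J' K' : finType)
    (T : tensor R I J K) (T' : tensor R I' J' K') r r' :
  sum_of_rank_ones r T -> sum_of_rank_ones r' T' ->
  sum_of_rank_ones (r * r') (kron T T').
Proof.
move=> [S [S1 ->]] [S' [S1' ->]].
have -> : kron (\sum_(s < r) S s) (\sum_(s < r') S' s) =
          \sum_(x : 'I_r * 'I_r') kron (S x.1) (S' x.2).
  apply/ffunP=> p; rewrite ffunE !sum_ffunE big_distrlr /= pair_bigA /=.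
  by apply: eq_bigr => x _; rewrite !ffunE.
rewrite -[X in sum_of_rank_ones X _](_ : #|{: 'I_r * 'I_r'}| = _); last first.
  by rewrite card_prod !card_ord.
apply: sum_of_rank_ones_fin => -[s s'].
have [a [b [c ->]]] := S1 s; have [a' [b' [c' ->]]] := S1' s'.
by rewrite kron_tens3; do 3!eexists.
Qed.

Lemma limit_of_rank_sums_kron (R : realType) (I J K I' J' K' : finType)
    (T : tensor R I J K) (T' : tensor R I' J' K') r r' :
  limit_of_rank_sums T r -> limit_of_rank_sums T' r' ->
  limit_of_rank_sums (kron T T') (r * r').
Proof.
move=> [u [ur uT]] [u' [ur' uT']]; exists (fun n => kron (u n) (u' n)); split.
  by move=> n; apply: sum_of_rank_ones_kron.
move=> p; rewrite ffunE; under eq_fun do rewrite ffunE.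
by apply: cvgM; [exact: uT|exact: uT'].
Qed.

Lemma limit_of_rank_sums_kron_pow (R : realType) (I J K : finType)
    (T : tensor R I J K) r N :
  limit_of_rank_sums T r -> limit_of_rank_sums (kron_pow T N) (r ^ N).
Proof.
move=> Tr; elim: N => [|N IHN] /=; last by rewrite expnS; exact: limit_of_rank_sums_kron.
exists (fun=> [ffun=> 1]); split=> [_|p]; last exact: cvg_cst.
apply: sum_of_rank_ones1; exists [ffun=> 1], [ffun=> 1], [ffun=> 1].
by apply/ffunP=> p; rewrite !ffunE !mulr1.
Qed.

Lemma cvg_harmonicC (R : realType) :
  (fun n => n.+1%:R^-1 : R[i]^o) @ \oo --> (0 : R[i]^o).
Proof.
apply/cvgrPdist_lt => e e0.
(* The norm of R[i] takes values in R[i]; a positive bound is real, which reduces the claim to the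
   real harmonic sequence. *)
have -> : e = (complex.Re e)%:C by apply/esym/RRe_real/gtr0_real.
have Re0 : 0 < complex.Re e by move: e0; rewrite ltcE => /andP[].
have /cvgrPdist_lt /(_ _ Re0) := @cvg_harmonic R.
apply: filterS => n; rewrite !sub0r !normrN /harmonic.
rewrite !ger0_norm ?invr_ge0 ?ler0n // => h.
rewrite (_ : n.+1%:R^-1 = (n.+1%:R^-1)%:C) ?ltcR //.
by rewrite fmorphV rmorph_nat.
Qed.

Section CoppersmithWinograd.
Variables (R : realType) (q : nat).
Let e := @basis_vec R 'I_q.+1.
Let l (j : 'I_q) : 'I_q.+1 := lift ord0 j.

(* The Coppersmith-Winograd degeneration: T_cw is the limit of [cw_approx t] as t
   tends to 0. *)
Definition cw_approx (t : R[i]) : tensor R 'I_q.+1 'I_q.+1 'I_q.+1 :=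
  \sum_(j < q) tens3 (t ^- 2 *: (e ord0 + t *: e (l j)))
      (e ord0 + t *: e (l j)) (e ord0 + t *: e (l j))
  + (tens3 (- t ^- 3 *: (e ord0 + t ^+ 2 *: \sum_(j < q) e (l j)))
           (e ord0 + t ^+ 2 *: \sum_(j < q) e (l j))
           (e ord0 + t ^+ 2 *: \sum_(j < q) e (l j))
     + tens3 ((t ^- 3 - q%:R * t ^- 2) *: e ord0) (e ord0) (e ord0)).

Lemma cw_approx_rank t : sum_of_rank_ones (q + 2) (cw_approx t).
Proof.
apply: sum_of_rank_onesD; last first.
  by apply: (@sum_of_rank_onesD _ _ _ _ 1 1); apply: sum_of_rank_ones1; do 3!eexists.
by eexists; split; last reflexivity; move=> s; do 3!eexists.
Qed.

Lemma T_cwE :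
  T_cw R q = \sum_(j < q) (tens3 (e ord0) (e (l j)) (e (l j)) +
    tens3 (e (l j)) (e ord0) (e (l j)) + tens3 (e (l j)) (e (l j)) (e ord0)).
Proof. by rewrite /T_cw big_mkcond big_ord_recl /= add0r. Qed.

(** The coefficients of t^-3, t^-2 and t^-1 cancel: the last tensor of [cw_approx] removes the
    multiples of e_0 (x) e_0 (x) e_0, the middle one the terms with a single factor s. The remainder
    is explicit, so that it visibly vanishes with t. *)
Lemma cw_approxE t p : t != 0 ->
  let s := \sum_(j < q) e (l j) in
  cw_approx t p = T_cw R q p
   + t * ((\sum_(j < q) tens3 (e (l j)) (e (l j)) (e (l j))) p
          - (tens3 (e ord0) s s + tens3 s (e ord0) s + tens3 s s (e ord0)) p)
   + t * t * t * - tens3 s s s p.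
Proof.
move=> t0; set s := \sum_(j < q) e (l j); move: p => [[x y] z] /=.
rewrite T_cwE /cw_approx -/s.
have E : (\sum_(j < q) tens3 (t ^- 2 *: (e ord0 + t *: e (l j)))
      (e ord0 + t *: e (l j)) (e ord0 + t *: e (l j))) (x, y, z) =
   t ^- 2 * (q%:R * (e ord0 x * e ord0 y * e ord0 z)
     + t * (e ord0 x * e ord0 y * s z + e ord0 x * s y * e ord0 z + s x * e ord0 y * e ord0 z)
     + t ^+ 2 * (\sum_(j < q) (tens3 (e ord0) (e (l j)) (e (l j)) +
    tens3 (e (l j)) (e ord0) (e (l j)) + tens3 (e (l j)) (e (l j)) (e ord0))) (x, y, z)
     + t ^+ 3 * (\sum_(j < q) tens3 (e (l j)) (e (l j)) (e (l j))) (x, y, z)).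
  have q1 : q%:R = \sum_(j < q) (1 : R[i]) by rewrite sumr_const card_ord.
  rewrite q1 /s !sum_ffunE.
  rewrite !(mulr_suml, mulr_sumr) -!big_split /= mulr_sumr -!big_split /= mulr_sumr.
  apply: eq_bigr => j _; rewrite !ffunE /= /GRing.scale /=.
  ring.
rewrite [LHS]ffunE E !ffunE /= /GRing.scale /=.
move: (\sum_(j < q) (_ + _ + _)) => T'.
move: (\sum_(j < q) _) => E'.
by field.
Qed.

Lemma T_cw_limit : limit_of_rank_sums (T_cw R q) (q + 2).
Proof.
exists (fun n => cw_approx n.+1%:R^-1); split=> [n|p]; first exact: cw_approx_rank.
under eq_fun do rewrite cw_approxE ?invr_eq0 ?pnatr_eq0 //.
have t0 := @cvg_harmonicC R.
have lim (a b c : R[i]^o) : (fun n : nat => a + n.+1%:R^-1 * b +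
    n.+1%:R^-1 * n.+1%:R^-1 * n.+1%:R^-1 * c : R[i]^o) @ \oo --> a.
  have E : a + 0 * b + 0 * 0 * 0 * c = a by rewrite !mul0r !addr0.
  rewrite -{2}E {E}.
  apply: cvgD; [apply: cvgD; [exact: cvg_cst|]|].
    by apply: cvgM; [|exact: cvg_cst].
  by apply: cvgM; [apply: cvgM; [apply: cvgM|]|exact: cvg_cst].
exact: lim.
Qed.

End CoppersmithWinograd.

End UpperBound.

(** * Gaussian elimination on sparse integer rows *)

Lemma Pos_eqb_axiom : Equality.axiom Pos.eqb.
Proof. by move=> x y; apply: (iffP idP) => /Pos.eqb_eq. Qed.

HB.instance Definition _ := hasDecEq.Build positive Pos_eqb_axiom.

(** A sparse row: column codes, meant to increase, with their coefficients. A [pivots] map stores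
    each row under its leading code. *)
Definition svec := seq (positive * Z).
Definition pivots := FMapPositive.PositiveMap.t svec.

(** Merges sorted rows into a u + b v. The inner fixpoint handles the steps that shorten only
    [v]. *)
Fixpoint scomb (a b : Z) (u : svec) : svec -> svec :=
  match u with
  | [::] => map (fun e => (e.1, Z.mul b e.2))
  | (c, x) :: u' =>
    fix scomb_u (v : svec) : svec :=
      match v with
      | [::] => map (fun e => (e.1, Z.mul a e.2)) u
      | (d, y) :: v' =>
        match Pos.compare c d with
        | Lt => (c, Z.mul a x) :: scomb a b u' v
        | Gt => (d, Z.mul b y) :: scomb_u v'
        | Eq => let z := Z.add (Z.mul a x) (Z.mul b y) in
                if Z.eqb z Z0 then scomb a b u' v' else (c, z) :: scomb a b u' v'
        end
      end
  end.

(** Fraction-free: y u - x v cancels the leading entry x of u against the leading entry y of the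
    pivot row v. Whatever the fuel, the result is a combination of [u] and pivot rows. *)
Fixpoint reduce (fuel : nat) (piv : pivots) (u : svec) : svec :=
  match fuel, u with
  | n.+1, (c, x) :: _ =>
    match FMapPositive.PositiveMap.find c piv with
    | Some (((_, y) :: _) as v) => reduce n piv (scomb y (Z.opp x) u v)
    | _ => u
    end
  | _, _ => u
  end.

Definition add_pivot (fuel : nat) (piv : pivots) (u : svec) : pivots :=
  match reduce fuel piv u with
  | [::] => piv
  | ((c, _) :: _) as v => FMapPositive.PositiveMap.add c v piv
  end.

Definition echelon (fuel : nat) (rows : seq svec) : pivots :=
  foldl (add_pivot fuel) (FMapPositive.PositiveMap.empty svec) rows.

(** * The Koszul flattening in explicit form and its eight blocks *)

(* A 5-coloring of the monomials a_i (x) a_j (x) a_k with i, j, k <= 5, found by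
   computer search: a monomial of color c < 5 is sent to e_c in C^5, one of color
   5 (and every monomial outside the table) is sent to 0. The cyclic shift of
   (i, j, k) permutes the colors by (1 2 3). *)
Definition color_table : seq (seq (seq nat)) :=
  [:: [:: [:: 0; 3; 4; 5; 2; 5];
         [:: 2; 5; 5; 5; 5; 5];
         [:: 4; 5; 5; 5; 5; 5];
         [:: 5; 5; 5; 5; 5; 4];
         [:: 1; 5; 2; 1; 5; 3];
         [:: 5; 5; 2; 5; 5; 5]];
      [:: [:: 1; 5; 5; 5; 5; 5];
         [:: 5; 5; 5; 1; 2; 4];
         [:: 5; 5; 5; 5; 5; 5];
         [:: 5; 3; 5; 5; 5; 5];
         [:: 5; 1; 2; 5; 5; 5];
         [:: 5; 4; 5; 5; 5; 4]];
      [:: [:: 4; 5; 5; 5; 3; 3];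
         [:: 5; 5; 5; 5; 3; 5];
         [:: 5; 5; 5; 5; 5; 5];
         [:: 5; 5; 5; 5; 5; 5];
         [:: 5; 5; 5; 5; 5; 5];
         [:: 5; 5; 5; 5; 5; 5]];
      [:: [:: 5; 5; 5; 5; 2; 5];
         [:: 5; 2; 5; 5; 5; 5];
         [:: 5; 5; 5; 5; 5; 5];
         [:: 5; 5; 5; 5; 5; 5];
         [:: 5; 5; 5; 5; 5; 3];
         [:: 4; 5; 5; 5; 5; 5]];
      [:: [:: 3; 5; 5; 5; 5; 5];
         [:: 5; 3; 5; 5; 5; 5];
         [:: 1; 1; 5; 5; 5; 5];
         [:: 3; 5; 5; 5; 5; 5];
         [:: 5; 5; 5; 5; 5; 5];
         [:: 2; 5; 5; 2; 5; 5]];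
      [:: [:: 5; 5; 5; 4; 1; 5];
         [:: 5; 4; 5; 5; 5; 4];
         [:: 1; 5; 5; 5; 5; 5];
         [:: 5; 5; 5; 5; 1; 5];
         [:: 5; 5; 5; 5; 5; 5];
         [:: 5; 4; 5; 5; 5; 5]]]%N.

Definition color (i j k : nat) : nat :=
  nth 5 (nth [::] (nth [::] color_table i) j) k.

Definition pairs : seq (nat * nat) :=
  [:: (0, 1); (0, 2); (0, 3); (0, 4); (1, 2); (1, 3); (1, 4); (2, 3); (2, 4);
      (3, 4)]%N.

Fixpoint inversions (s : seq nat) : nat :=
  if s is x :: s' then (count (ltn^~ x) s' + inversions s')%N else 0%N.

(* Entries of the map e_s /\ _ : Lambda^2 -> Lambda^3 = (Lambda^2)^*, both sides
   in the basis [pairs]: the row of e_p /\ e_p' is nonzero only in the column of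
   the complementary pair. *)
Definition wedge_table : seq (seq (seq (nat * Z))) :=
  Eval vm_compute in
  let sgn n := if odd n then Zneg xH else Zpos xH in
  let pair P := nth (0, 0)%N pairs P in
  let word s P Q := [:: s; (pair P).1; (pair P).2; (pair Q).1; (pair Q).2] in
  [seq [seq [seq (Q, sgn (inversions (word s P Q)))
            | Q <- iota 0 10 & uniq (word s P Q)]
       | P <- iota 0 10] | s <- iota 0 5].

(** Color 5 falls outside the table, so the default value makes it act as 0. *)
Definition wedge (s P : nat) : seq (nat * Z) :=
  nth [::] (nth [::] wedge_table s) P.

(* For a fixed b-index [b], the pairs (c-index, a-index) with nonzero coefficient
   in T_cw and a-index at most 5. [inner] means [b <= 5]; otherwise only (b, 0)
   remains and the c-index, which is determined by the block, is recorded as 0. *)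
Definition nbr (inner : bool) (b : nat) : seq (nat * nat) :=
  if ~~ inner then [:: (0, 0)]
  else if b == 0 then [seq (g, g) | g <- iota 1 5] else [:: (b, 0); (0, b)].

(* The leading entry of a row is the one of smallest code; with this ordering of
   the columns (and the rows sorted by length) elimination causes little fill-in
   and the coefficients stay below 5 in absolute value. *)
Definition enc (g0 g1 g2 q : nat) : positive :=
  N.succ_pos (N.sub 2159 (N.add (N.mul (N.add (N.mul (N.add (N.mul
    (N.of_nat g1) 6) (N.of_nat g0)) 10) (N.of_nat q)) 6) (N.of_nat g2))).

Definition dec (c : positive) : nat * nat * nat * nat :=
  let (n, g2) := N.div_eucl (N.sub 2160 (Npos c)) 6 in
  let (n, q) := N.div_eucl n 10 in
  let (g1, g0) := N.div_eucl n 6 in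
  (N.to_nat g0, N.to_nat g1, N.to_nat g2, N.to_nat q).

(** Inserting the entries one at a time by [scomb] sorts them and merges those in the same
    column. *)
Definition koszul_row (s0 s1 s2 : bool) (b0 b1 b2 P : nat) : svec :=
  foldr (fun e u => scomb (Zpos xH) (Zpos xH) [:: e] u) [::]
    (flatten [seq flatten [seq flatten [seq
      [seq (enc p0.1 p1.1 p2.1 w.1, w.2) | w <- wedge (color p0.2 p1.2 p2.2) P]
      | p2 <- nbr s2 b2] | p1 <- nbr s1 b1] | p0 <- nbr s0 b0]).

Definition rng (inner : bool) := iota 0 (if inner then 6 else 1)%N.

Definition koszul_rows (s0 s1 s2 : bool) : seq svec :=
  flatten [seq flatten [seq flatten [seq [seq koszul_row s0 s1 s2 b0 b1 b2 P
     | P <- iota 0 10] | b2 <- rng s2] | b1 <- rng s1] | b0 <- rng s0].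

(** There are at most 6^3 * 10 = 2160 columns, and each reduction step raises the leading code, so
    the fuel suffices. *)
Definition koszul_pivots (s0 s1 s2 : bool) : pivots :=
  echelon 2160%N (sort (relpre size leq) (koszul_rows s0 s1 s2)).

(** Codes of genuine columns of the block; on these [dec] is injective, since [enc] recovers the
    code. *)
Definition valid (s0 s1 s2 : bool) (c : positive) : bool :=
  let '(g0, g1, g2, q) := dec c in
  [&& Pos.eqb (enc g0 g1 g2 q) c, (g0 < if s0 then 6 else 1)%N, (g1 < if s1 then 6 else 1)%N,
      (g2 < if s2 then 6 else 1)%N & (q < 10)%N].

(** The echelon shape of the output is checked row by row, so that nothing has to be proved about
    the shape that the elimination produces. *)
Definition good_pivot s0 s1 s2 (piv : pivots) (n : nat) : bool :=
  let c := Pos.of_succ_nat n in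
  if FMapPositive.PositiveMap.find c piv is Some ((d, y) :: u) then
    [&& Pos.eqb d c, ~~ Z.eqb y Z0, valid s0 s1 s2 c, all (fun e => Pos.ltb c e.1) u
      & all (fun e => valid s0 s1 s2 e.1) u]
  else false.

Definition pivot_count s0 s1 s2 :=
  count (good_pivot s0 s1 s2 (koszul_pivots s0 s1 s2)) (iota 0 2160).

Lemma pivot_countE s0 s1 s2 :
  pivot_count s0 s1 s2 =
  (6 * ((if s0 then 7 else 1) * ((if s1 then 7 else 1) * (if s2 then 7 else 1))))%N.
Proof.
(* All eight eliminations are run inside this closed boolean. *)
have : all (fun s0 => all (fun s1 => all (fun s2 => pivot_count s0 s1 s2 ==
    (6 * ((if s0 then 7 else 1) *
          ((if s1 then 7 else 1) * (if s2 then 7 else 1))))%N)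
  [:: true; false]) [:: true; false]) [:: true; false] by vm_compute.
have inb (b : bool) : b \in [:: true; false] by case: b.
by move=> /allP/(_ _ (inb s0))/allP/(_ _ (inb s1))/allP/(_ _ (inb s2))/eqP.
Qed.

(** * Soundness of the elimination over a ring *)

Definition Zinj (F : nzRingType) (z : Z) : F := (int_of_Z z)%:~R.

Lemma ZinjD (F : nzRingType) (x y : Z) : Zinj F (Z.add x y) = Zinj F x + Zinj F y.
Proof. by rewrite /Zinj -intrD -rmorphD. Qed.

Lemma ZinjM (F : nzRingType) (x y : Z) : Zinj F (Z.mul x y) = Zinj F x * Zinj F y.
Proof. by rewrite /Zinj -intrM -rmorphM. Qed.

Lemma Zinj_neq0 (F : numDomainType) (z : Z) : ~~ Z.eqb z Z0 -> Zinj F z != 0.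
Proof.
rewrite /Zinj intr_eq0; apply: contra => /eqP z0.
by apply/Z.eqb_spec; rewrite -[z]int_of_ZK z0.
Qed.

(** Pairing of a sparse row with the column vector whose entry at code c is [psi c]. *)
Definition seval (F : nzRingType) (psi : positive -> F) (u : svec) : F :=
  \sum_(e <- u) Zinj F e.2 * psi e.1.

Lemma seval_scale (F : nzRingType) (psi : positive -> F) (b : Z) (u : svec) :
  seval psi [seq (e.1, Z.mul b e.2) | e <- u] = Zinj F b * seval psi u.
Proof.
rewrite /seval big_map mulr_sumr; apply: eq_bigr => e _ /=.
by rewrite ZinjM mulrA.
Qed.

Lemma seval_cons (F : nzRingType) (psi : positive -> F) c x (u : svec) :
  seval psi ((c, x) :: u) = Zinj F x * psi c + seval psi u.
Proof. by rewrite /seval big_cons. Qed.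

Lemma seval_scomb (F : comNzRingType) (psi : positive -> F) (a b : Z)
    (u v : svec) :
  seval psi (scomb a b u v) = Zinj F a * seval psi u + Zinj F b * seval psi v.
Proof.
elim: u v => [|[c x] u IHu] v.
  by rewrite seval_scale [X in Zinj F a * X]/seval big_nil mulr0 add0r.
elim: v => [|[d y] v IHv]; first by
  rewrite [LHS]seval_scale [X in Zinj F b * X]/seval big_nil mulr0 addr0.
rewrite /= -/(scomb a b); case: Pos.compare_spec => [<-|_|_].
- case: Z.eqb_spec => [z0|_].
    rewrite IHu !seval_cons.
    have : Zinj F a * Zinj F x + Zinj F b * Zinj F y = 0 by rewrite -!ZinjM -ZinjD z0.
    move=> e; transitivity ((Zinj F a * Zinj F x + Zinj F b * Zinj F y) * psi c +
      (Zinj F a * seval psi u + Zinj F b * seval psi v)); last by ring.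
    by rewrite e mul0r add0r.
  rewrite !seval_cons IHu ZinjD !ZinjM; ring.
- rewrite !seval_cons IHu !seval_cons ZinjM; ring.
- rewrite !seval_cons IHv !seval_cons ZinjM; ring.
Qed.

(* If every functional vanishing on the input rows vanishes on the pivot rows,
   then the pivot rows lie in the row space. *)
Definition kills (F : nzRingType) (psi : positive -> F) (piv : pivots) :=
  forall c u, FMapPositive.PositiveMap.find c piv = Some u -> seval psi u = 0.

Lemma seval_reduce (F : comNzRingType) (psi : positive -> F) fuel piv u :
  kills psi piv -> seval psi u = 0 -> seval psi (reduce fuel piv u) = 0.
Proof.
move=> Hpiv; elim: fuel u => [|n IHn] //= [|[c x] u] // Hu.
case E: (FMapPositive.PositiveMap.find c piv) => [[|[d y] v]|] //.
by apply: IHn; rewrite seval_scomb Hu (Hpiv _ _ E) !mulr0 addr0.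
Qed.

Lemma kills_echelon (F : comNzRingType) (psi : positive -> F) fuel rows :
  all (fun u => seval psi u == 0) rows -> kills psi (echelon fuel rows).
Proof.
rewrite /echelon.
have : kills psi (FMapPositive.PositiveMap.empty svec).
  by move=> c u; rewrite FMapPositive.PositiveMap.gempty.
elim: rows (FMapPositive.PositiveMap.empty svec) => //= u rows IH piv Hpiv.
move=> /andP[/eqP Hu Hrows]; apply: IH Hrows.
rewrite /add_pivot; have := @seval_reduce F psi fuel piv u Hpiv Hu.
case: (reduce fuel piv u) => [|[c x] v] // Hv d w.
case: (Pos.eq_dec d c) => [->|dc].
  by rewrite FMapPositive.PositiveMap.gss => -[<-].
by rewrite FMapPositive.PositiveMap.gso //; apply: Hpiv.
Qed.

(* Index in {0..q} of the inner index [g <= 5] if [m = 0], and the [m]-th outer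
   index [m + 5] otherwise. *)
Definition emb (m g : nat) : nat := if m == 0%N then g else (m + 5)%N.

Lemma seval_koszul_row (F : comNzRingType) (psi : positive -> F) s0 s1 s2 b0 b1 b2 P :
  seval psi (koszul_row s0 s1 s2 b0 b1 b2 P) =
  \sum_(p0 <- nbr s0 b0) \sum_(p1 <- nbr s1 b1) \sum_(p2 <- nbr s2 b2)
    \sum_(w <- wedge (color p0.2 p1.2 p2.2) P)
      Zinj F w.2 * psi (enc p0.1 p1.1 p2.1 w.1).
Proof.
rewrite /koszul_row; set l := flatten _.
have -> : seval psi (foldr (fun e u => scomb (Zpos xH) (Zpos xH) [:: e] u) [::] l)
          = seval psi l.
  elim: l => [|e l IHl] //.
  rewrite -[foldr _ _ _]/(scomb (Zpos xH) (Zpos xH) [:: e]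
    (foldr (fun e u => scomb (Zpos xH) (Zpos xH) [:: e] u) [::] l)).
  rewrite seval_scomb IHl.
  have z1 : Zinj F (Zpos xH) = 1 by rewrite /Zinj rmorph1.
  by rewrite z1 !mul1r /seval !big_cons big_nil addr0.
rewrite /l /seval big_flatten big_map; apply: eq_bigr => p0 _.
rewrite big_flatten big_map; apply: eq_bigr => p1 _.
rewrite big_flatten big_map; apply: eq_bigr => p2 _.
by rewrite big_map.
Qed.

Definition enc_range :=
  [seq (g, q)
  | g <- [seq (g', g2)
         | g' <- [seq (g0, g1) | g0 <- iota 0 6, g1 <- iota 0 6],
           g2 <- iota 0 6],
    q <- iota 0 10].

Lemma dec_enc g0 g1 g2 q : (g0 < 6)%N -> (g1 < 6)%N -> (g2 < 6)%N -> (q < 10)%N ->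
  dec (enc g0 g1 g2 q) = (g0, g1, g2, q).
Proof.
have : all (fun x => dec (enc x.1.1.1 x.1.1.2 x.1.2 x.2) == x) enc_range.
  by vm_compute.
move=> /allP H h0 h1 h2 hq; apply/eqP.
apply: (H (g0, g1, g2, q)).
by rewrite /enc_range !allpairs_f // mem_iota.
Qed.

Lemma sum_ord_foldr (n : nat) (f : nat -> Z) :
  \sum_(i < n) f i = foldr (fun i z => Z.add (f i) z) Z0 (iota 0 n).
Proof. by rewrite -(big_mkord xpredT f) unlock /index_iota subn0. Qed.

Lemma sum_Zinj (F : nzRingType) (n : nat) (f : nat -> Z) :
  \sum_(i < n) Zinj F (f i) = Zinj F (foldr (fun i z => Z.add (f i) z) Z0 (iota 0 n)).
Proof. by rewrite -sum_ord_foldr /Zinj !rmorph_sum. Qed.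

Definition coef_at (l : seq (nat * Z)) (Q : nat) : Z :=
  foldr (fun w z => if w.1 == Q then Z.add w.2 z else z) Z0 l.

(** Entries of e_s /\ _ : C^5 -> Lambda^2 in the basis [pairs]. *)
Definition wedge1 (s i P : nat) : Z :=
  let p := nth (0, 0)%N pairs P in
  if p == (s, i) then Zpos xH else if p == (i, s) then Zneg xH else Z0.

(** * The rank of exterior multiplication by a vector of C^5 *)

Section Koszul.
Variable F : numFieldType.

Definition wedge_mx (s : nat) : 'M[F]_10 := \matrix_(P, Q) Zinj F (coef_at (wedge s P) Q).
Definition wedge1_mx (s : nat) : 'M[F]_(5, 10) := \matrix_(i, P) Zinj F (wedge1 s i P).

(** The transpose is contraction with the dual of e_s, which sends e_t /\ e_i to delta_ts e_i -
    delta_is e_t. *)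
Lemma wedge1_mx_trmx (s t : nat) : (s < 5)%N -> (t < 5)%N ->
  wedge1_mx t *m (wedge1_mx s)^T =
  \matrix_(i, j) (((t == s) && (i == j))%:R - ((t == j) && (i == s :> nat))%:R).
Proof.
have : all (fun s => all (fun t => all (fun i => all (fun j =>
    Z.eqb (foldr (fun P z => Z.add (Z.mul (wedge1 t i P) (wedge1 s j P)) z) Z0 (iota 0 10))
     (Z.sub (if (t == s) && (i == j) then Zpos xH else Z0) (if (t == j) && (i == s) then Zpos xH else Z0)))
     (iota 0 5)) (iota 0 5)) (iota 0 5)) (iota 0 5).
  by vm_compute.
move=> /allP H s5 t5; apply/matrixP=> i j; rewrite !mxE.
have memP n (k : 'I_n) : val k \in iota 0 n by rewrite mem_iota ltn_ord.
have s5' : s \in iota 0 5 by rewrite mem_iota.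
have t5' : t \in iota 0 5 by rewrite mem_iota.
have /allP/(_ _ (memP _ j))/Z.eqb_spec E := allP (allP (H s s5') t t5') _ (memP _ i).
transitivity (\sum_(P < 10) Zinj F (Z.mul (wedge1 t i P) (wedge1 s j P))).
  by apply: eq_bigr => P _; rewrite !mxE ZinjM.
rewrite (sum_Zinj F 10 (fun P => Z.mul (wedge1 t i P) (wedge1 s j P))) E /Zinj.
rewrite -[(i == j)]/(val i == val j).
by case: (_ && _); case: (_ && _); rewrite /= ?subr0 ?subrr ?sub0r ?mulrN1z.
Qed.

(** Anticommutativity e_t /\ e_s /\ v = - e_s /\ e_t /\ v, for matrices acting on row vectors;
    checked entry by entry. *)
Lemma wedge1_mx_wedge_mx (s t : nat) : (s < 5)%N -> (t < 5)%N ->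
  wedge1_mx s *m wedge_mx t + wedge1_mx t *m wedge_mx s = 0.
Proof.
have : all (fun s => all (fun t => all (fun i => all (fun Q =>
    Z.eqb (foldr (fun P z => Z.add (Z.add (Z.mul (wedge1 s i P) (coef_at (wedge t P) Q))
                                          (Z.mul (wedge1 t i P) (coef_at (wedge s P) Q))) z) Z0 (iota 0 10))
     Z0)
     (iota 0 10)) (iota 0 5)) (iota 0 5)) (iota 0 5).
  by vm_compute.
move=> /allP H s5 t5; apply/matrixP=> i Q; rewrite !mxE -big_split /=.
have memP n (k : 'I_n) : val k \in iota 0 n by rewrite mem_iota ltn_ord.
have s5' : s \in iota 0 5 by rewrite mem_iota.
have t5' : t \in iota 0 5 by rewrite mem_iota.
have /allP/(_ _ (memP _ Q))/Z.eqb_spec E := allP (allP (H s s5') t t5') _ (memP _ i).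
transitivity (\sum_(P < 10) Zinj F (Z.add (Z.mul (wedge1 s i P) (coef_at (wedge t P) Q))
                                          (Z.mul (wedge1 t i P) (coef_at (wedge s P) Q)))).
  by apply: eq_bigr => P _; rewrite !mxE ZinjD !ZinjM.
by rewrite (sum_Zinj F 10 (fun P => Z.add (Z.mul (wedge1 s i P) (coef_at (wedge t P) Q))
                                          (Z.mul (wedge1 t i P) (coef_at (wedge s P) Q)))) E.
Qed.

(** For x nonzero, x /\ C^5 has dimension at least 4 and lies in the kernel of x /\ _ on the
    10-dimensional Lambda^2, which leaves rank at most 10 - 4. *)
Lemma wedge_mx_rank (x : 'I_5 -> F) : (\rank (\sum_(s < 5) x s *: wedge_mx s)%R <= 6)%N.
Proof.
set W := (X in \rank X).
case: (pickP (fun s => x s != 0)) => [s xs|x0]; last first.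
  rewrite /W big1 ?mxrank0 // => s _.
  by move: (x0 s) => /eqP ->; rewrite scale0r.
pose W1 := \sum_(t < 5) x t *: wedge1_mx t.
(* x /\ (x /\ _) = 0. *)
have W1W : W1 *m W = 0.
  (* In the doubled sum, exchanging the two indices in one copy makes the terms cancel in pairs;
     characteristic 0 then removes the factor 2. *)
  have : W1 *m W + W1 *m W = 0.
    have E : W1 *m W = \sum_(t < 5) \sum_(u < 5) (x t * x u) *: (wedge1_mx t *m wedge_mx u).
      rewrite /W1 /W mulmx_suml; apply: eq_bigr => t _; rewrite mulmx_sumr.
      by apply: eq_bigr => u _; rewrite -scalemxAl -scalemxAr scalerA.
    rewrite {2}E exchange_big E -big_split /= big1 // => t _.
    rewrite -big_split /= big1 // => u _.
    by rewrite [x u * _]mulrC -scalerDr wedge1_mx_wedge_mx // scaler0.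
  by move/eqP; rewrite -mulr2n -scaler_nat scaler_eq0 pnatr_eq0 /= => /eqP.
(* Contracting with the dual of e_s: x /\ e_i is sent to x_s e_i - (i == s) x. *)
have W1r : (4 <= \rank W1)%N.
  pose d : 'cV[F]_5 := \col_i (i == s)%:R.
  pose r : 'rV[F]_5 := \row_j x j.
  have E : W1 *m (wedge1_mx s)^T + d *m r = (x s)%:M.
    apply/matrixP=> i j; rewrite mulmx_suml [LHS]mxE summxE [(d *m r) i j]mxE big_ord1.
    rewrite (eq_bigr (fun t : 'I_5 => x t * ((t == s) && (i == j))%:R
                                      - x t * ((t == j) && (i == s))%:R)); last first.
      by move=> t _; rewrite -scalemxAl wedge1_mx_trmx // !mxE mulrBr.
    rewrite sumrB (bigD1 s) //= eqxx /= big1 ?addr0; last first.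
      by move=> t /negPf ->; rewrite mulr0.
    rewrite (bigD1 j) //= eqxx /= big1 ?addr0; last first.
      by move=> t /negPf ->; rewrite mulr0.
    rewrite !mxE [x j * _]mulrC -addrA addNr addr0.
    by case: (i == j); rewrite ?mulr1 ?mulr0.
  (* An invertible scalar matrix of size 5 is a multiple of [W1] plus a matrix of rank at most 1. *)
  have : \rank (W1 *m (wedge1_mx s)^T + d *m r)%R = 5%N.
    by rewrite E -scalemx1 mxrank_scale_nz // mxrank1.
  move=> E5; have := mxrank_add (W1 *m (wedge1_mx s)^T) (d *m r); rewrite E5.
  have := mulmx_max_rank d r; have := mxrankM_maxl W1 (wedge1_mx s)^T.
  move=> A B C; rewrite -ltnS; apply: leq_trans C _.
  by apply: leq_trans (leq_add A B) _; rewrite addn1.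
have := mulmx0_rank_max W1W; move=> H.
by rewrite -(leq_add2l 4); apply: leq_trans (leq_add W1r (leqnn _)) H.
Qed.

End Koszul.

(** * Rank from echelon vectors, and slices of [T_cw] *)

(** The vectors [g d] lie in the row space because the kernel of [A] annihilates them. They are
    independent: at position [y d] a linear relation involves only [d] and vectors of smaller key,
    so induction on the key kills every coefficient. *)
Lemma echelon_rank (F : fieldType) (D E : finType) m (A : 'M[F]_(m, #|E|))
    (g : D -> E -> F) (y : D -> E) (key : D -> nat) :
    (forall d, g d (y d) != 0) ->
    (forall d d', g d' (y d) != 0 -> d' = d \/ (key d' < key d)%N) ->
    (forall Phi : 'cV_#|E|, A *m Phi = 0 ->
       forall d, \sum_e g d e * Phi (enum_rank e) 0 = 0) ->
  (#|D| <= \rank A)%N.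
Proof.
move=> gy gkey gA.
pose G : 'M[F]_(#|D|, #|E|) := \matrix_(i, j) g (enum_val i) (enum_val j).
(* The columns of [cokermx A] are kernel vectors of [A], and annihilation by all of them
   characterizes the row space. *)
have GA : (G <= A)%MS.
  rewrite submxE; apply/eqP/matrixP=> i j; rewrite !mxE.
  rewrite -[RHS](gA (col j (cokermx A)) _ (enum_val i)); last first.
    by rewrite colE mulmxA mulmx_coker mul0mx.
  rewrite (reindex (@enum_val _ E)) /=; last exact: onW_bij (enum_val_bij E).
  by apply: eq_bigr => k _; rewrite !mxE enum_valK.
have : row_free G.
  apply: inj_row_free => v vG; apply/rowP=> i; rewrite mxE.
  have [n] := ubnP (key (enum_val i)); elim: n i => // n IHn i; rewrite ltnS => ni.
  have := congr1 (fun M : 'rV_#|E| => M 0 (enum_rank (y (enum_val i)))) vG.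
  rewrite !mxE (bigD1 i) //= big1 ?addr0 => [|k ki].
    rewrite !mxE enum_rankK => /eqP; rewrite mulf_eq0 (negPf (gy _)) orbF.
    by move/eqP.
  rewrite !mxE enum_rankK; case: (eqVneq (g (enum_val k) (y (enum_val i))) 0) => [->|].
    by rewrite mulr0.
  move=> /gkey[/enum_val_inj e|lt]; first by rewrite e eqxx in ki.
  by rewrite IHn ?mul0r //; apply: leq_trans lt _.
by move/eqP <-; apply: mxrankS.
Qed.

(** The slice of [T_cw] at b-index j is supported on (0, j) and (j, 0) if j > 0, and on the (l, l)
    with l > 0 if j = 0. The vanishing of [H] above a-index 5 leaves the pairs of [nbr],
    independently of q. *)
Lemma cw_slice (R : realType) (q m b : nat) (H : nat -> nat -> R[i]) :
    (m + 5 <= q)%N -> (b < if m == 0 then 6 else 1)%N ->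
    (forall i k, (5 < i)%N -> H i k = 0) ->
  \sum_(i < q.+1) \sum_(k < q.+1) T_cw R q (i, inord (emb m b), k) * H i k =
  \sum_(p <- nbr (m == 0%N) b) H p.2 (emb m p.1).
Proof.
move=> mq bm H0; have q5 : (5 <= q)%N by lia.
set j : 'I_q.+1 := inord _.
have jE : j = emb m b :> nat.
  rewrite /j inordK // /emb; move: bm; case: (m == 0%N) => ?; lia.
have -> : \sum_(i < q.+1) \sum_(k < q.+1) T_cw R q (i, j, k) * H i k =
  \sum_(l < q.+1 | l != ord0) ((j == l)%:R * H 0 l + (j == ord0)%:R * H l l
                               + (j == l)%:R * H l 0).
  have delta (f : 'I_q.+1 -> R[i]) (x : 'I_q.+1) : \sum_i (i == x)%:R * f i = f x.
    rewrite (bigD1 x) //= eqxx mul1r big1 ?addr0 // => i /negPf ->.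
    by rewrite mul0r.
  transitivity (\sum_(l < q.+1 | l != ord0) \sum_(i < q.+1) \sum_(k < q.+1)
    ((i == ord0)%:R * ((k == l)%:R * ((j == l)%:R * H i k)) +
     (i == l)%:R * ((k == l)%:R * ((j == ord0)%:R * H i k)) +
     (i == l)%:R * ((k == ord0)%:R * ((j == l)%:R * H i k)))).
    rewrite [RHS]exchange_big; apply: eq_bigr => i _.
    rewrite [RHS]exchange_big; apply: eq_bigr => k _.
    rewrite /T_cw sum_ffunE mulr_suml; apply: eq_bigr => l _.
    rewrite !ffunE /= !mulrDl; congr (_ + _ + _); rewrite -!mulrA; congr (_ * _);
      by rewrite mulrCA.
  apply: eq_bigr => l _.
  under eq_bigr do rewrite !big_split -!mulr_sumr /= !delta.
  by rewrite !big_split /= !delta.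
have [m0|m0] := eqVneq m 0%N; last first.
  have b0 : b = 0%N by move: bm; rewrite (negPf m0); case: b {j jE}.
  move: jE; rewrite /emb (negPf m0) => jE.
  have j0 : j != ord0 by rewrite -val_eqE /= jE; lia.
  rewrite (bigD1 j) //= eqxx (negPf j0) !mul1r mul0r addr0 big1 => [|l /andP[_ lj]].
    by rewrite addr0 /nbr /= big_seq1 /= jE [H (m + 5)%N 0%N]H0 ?addr0 //; lia.
  by rewrite eq_sym (negPf lj) !mul0r !addr0.
move: bm jE; rewrite m0 /emb !eqxx /nbr /= => b6 jE.
have [b0|b0] := eqVneq b 0%N; last first.
  have j0 : j != ord0 by rewrite -val_eqE /= jE.
  rewrite (bigD1 j) //= eqxx (negPf j0) !mul1r mul0r addr0 big1 => [|l /andP[_ lj]].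
    by rewrite addr0 !big_cons big_nil /= jE addr0 addrC.
  by rewrite eq_sym (negPf lj) !mul0r !addr0.
have -> : j = ord0 by apply/val_inj; rewrite /= jE b0.
transitivity (\sum_(l < q.+1 | l != ord0) H l l).
  by apply: eq_bigr => l l0; rewrite eqxx eq_sym (negPf l0) !mul0r mul1r add0r addr0.
transitivity (\sum_(1 <= l < 6) H l l); last first.
  by rewrite /index_iota /= !big_cons !big_nil.
transitivity (\sum_(1 <= l < q.+1) H l l).
  rewrite big_mkcond -(big_mkord xpredT (fun l => if l != 0%N then H l l else 0)).
  rewrite big_ltn //= add0r big_nat [RHS]big_nat; apply: eq_bigr => l.
  by case: l.
rewrite (@big_cat_nat _ _ _ 6) //= [X in _ + X]big_nat [X in _ + X]big1 ?addr0 //.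
by move=> l /andP[l6 _]; rewrite H0.
Qed.
Lemma color_out i j k : [|| 5 < i, 5 < j | 5 < k]%N -> color i j k = 5%N.
Proof.
rewrite /color; have [i6|i6] := leqP i 5; last first.
  by rewrite (@nth_default _ _ color_table) // !nth_nil.
have [j6|j6] := leqP j 5; last first.
  move=> _; rewrite [nth [::] _ j]nth_default ?nth_nil //.
  by move: i i6; do 6?[case=> //].
rewrite /= => k6; rewrite nth_default //.
have : all (fun i => all (fun j => size (nth [::] (nth [::] color_table i) j) == 6)%N
  (iota 0 6)) (iota 0 6) by [].
have iI : i \in iota 0 6 by rewrite mem_iota.
have jI : j \in iota 0 6 by rewrite mem_iota.
by move=> /allP/(_ i iI)/allP/(_ j jI)/eqP ->.
Qed.

Lemma wedge_lt s P w : w \in wedge s P -> (w.1 < 10)%N.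
Proof.
have : all (fun s => all (fun P => all (fun w => w.1 < 10)%N (wedge s P)) (iota 0 10)) (iota 0 5).
  by vm_compute.
move=> /allP H; have [s5|s5] := ltnP s 5; last first.
  by rewrite /wedge (@nth_default _ _ wedge_table s) // nth_nil.
have [P10|P10] := ltnP P 10; last first.
  rewrite /wedge [nth _ _ P]nth_default //.
  by case: s s5 => [|[|[|[|[|]]]]].
have sI : s \in iota 0 5 by rewrite mem_iota.
have PI : P \in iota 0 10 by rewrite mem_iota.
by move/allP: (H s sI) => /(_ P PI)/allP; apply.
Qed.

Lemma sum_coef_at (F : nzRingType) n (l : seq (nat * Z)) (h : nat -> F) :
    (forall w, w \in l -> (w.1 < n)%N) ->
  \sum_(w <- l) Zinj F w.2 * h w.1 = \sum_(Q < n) Zinj F (coef_at l Q) * h Q.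
Proof.
elim: l => [|w l IHl] ln.
  by rewrite big_nil big1 // => Q _; rewrite /Zinj /= mul0r.
rewrite big_cons IHl; last by move=> v vl; apply: ln; rewrite inE vl orbT.
have w10 : (w.1 < n)%N by apply: ln; rewrite inE eqxx.
rewrite [RHS](bigD1 (Ordinal w10)) // [X in _ + X](bigD1 (Ordinal w10)) //=.
rewrite eqxx ZinjD mulrDl addrA; congr (_ + _).
apply: eq_bigr => Q; rewrite -val_eqE /= eq_sym => /negPf ->; reflexivity.
Qed.

Lemma nbr_lt (s : bool) b p : (b < if s then 6 else 1)%N -> p \in nbr s b -> (p.1 < 6)%N.
Proof.
rewrite /nbr; case: s => /= b6; last by rewrite inE => /eqP ->.
case: eqP => _; first by rewrite !inE => /or4P[/eqP->|/eqP->|/eqP->|/orP[]/eqP->].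
by rewrite !inE => /orP[]/eqP->.
Qed.

Lemma of_succ_nat_lt m n :
  Pos.lt (Pos.of_succ_nat m) (Pos.of_succ_nat n) -> (m < n)%N.
Proof. lia. Qed.

Lemma all_flatten (T : Type) (a : pred T) (ss : seq (seq T)) :
  all a (flatten ss) = all (all a) ss.
Proof. by elim: ss => //= s ss IHss; rewrite all_cat IHss. Qed.

(** * Lower bound: the rank of the flattening of the cube *)

Section LowerBound.
Variables (R : realType) (q : nat).
Hypothesis q5 : (5 <= q)%N.
Let o := (q - 5)%N.
Let I3 : finType := idx_pow 'I_q.+1 3%N.
Let E : finType := (I3 * 'I_10)%type.

Definition color_mx (i : I3) : 'M[R[i]]_10 := wedge_mx _ (color i.1 i.2.1 i.2.2.1).

Lemma wedge_mx_out (K : numFieldType) s : (5 <= s)%N -> wedge_mx K s = 0.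
Proof.
move=> s5; apply/matrixP=> P Q; rewrite !mxE /wedge.
by rewrite (@nth_default _ _ wedge_table s) ?nth_nil.
Qed.

(** Grouping the monomials by color turns the sum into x /\ _ for a single x in C^5. *)
Lemma color_mx_rank (a : I3 -> R[i]) : (\rank (\sum_i a i *: color_mx i)%R <= 6)%N.
Proof.
pose c (i : I3) := color i.1 i.2.1 i.2.2.1.
pose x (s : 'I_5) := \sum_(i | c i == s) a i.
have -> : \sum_i a i *: color_mx i = \sum_(s < 5) x s *: wedge_mx _ s.
  under [RHS]eq_bigr do rewrite scaler_suml big_mkcond.
  rewrite [RHS]exchange_big; apply: eq_bigr => i _.
  rewrite /color_mx -/(c i); have [c5|c5] := ltnP (c i) 5.
    rewrite (bigD1 (Ordinal c5)) //= eqxx big1 ?addr0 // => s.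
    by rewrite -val_eqE /= eq_sym => /negPf ->.
  rewrite wedge_mx_out // scaler0 big1 // => s _.
  by case: eqP => // cs; move: c5; rewrite cs leqNgt ltn_ord.
exact: wedge_mx_rank.
Qed.

Definition idx3 (k0 k1 k2 Q : nat) : E :=
  ((inord k0, (inord k1, (inord k2, tt))), inord Q).

(** The column of the full flattening that a code stands for in block (m0, m1, m2). *)
Definition pos (m0 m1 m2 : nat) (c : positive) : E :=
  let '(g0, g1, g2, Q) := dec c in idx3 (emb m0 g0) (emb m1 g1) (emb m2 g2) Q.

Definition koszul_flat := flat color_mx (kron_pow (T_cw R q) 3%N).

Lemma sum_I3 (f : I3 -> R[i]) :
  \sum_k f k = \sum_(k0 < q.+1) \sum_(k1 < q.+1) \sum_(k2 < q.+1)
     f (k0, (k1, (k2, tt))).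
Proof.
rewrite (eq_bigr (fun k => f (k.1, k.2))) => [|[] //].
rewrite -(pair_bigA _ (fun k0 k' => f (k0, k'))) /=; apply: eq_bigr => k0 _.
rewrite (eq_bigr (fun k => f (k0, (k.1, k.2)))) => [|[] //].
rewrite -(pair_bigA _ (fun k1 k' => f (k0, (k1, k')))) /=; apply: eq_bigr => k1 _.
rewrite (eq_bigr (fun k => f (k0, (k1, (k.1, k.2))))) => [|[k []] //].
rewrite -(pair_bigA _ (fun k2 k' => f (k0, (k1, (k2, k'))))) /=; apply: eq_bigr => k2 _.
by rewrite (big_pred1 tt) => [|[]//].
Qed.

(** * Kernel vectors of the flattening annihilate the rows of every block *)

Section Kernel.
Variable Phi : 'cV[R[i]]_#|E|.
Hypothesis kerPhi : koszul_flat *m Phi = 0.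
Let phi k0 k1 k2 Q := Phi (enum_rank (idx3 k0 k1 k2 Q)) 0.

(** One row of [kerPhi], with the sums nested so that the three factors can be sliced one after the
    other. *)
Lemma koszul_flat_ker (j0 j1 j2 : 'I_q.+1) (P : 'I_10) :
  \sum_(i0 < q.+1) \sum_(k0 < q.+1) T_cw R q (i0, j0, k0) *
  \sum_(i1 < q.+1) \sum_(k1 < q.+1) T_cw R q (i1, j1, k1) *
  \sum_(i2 < q.+1) \sum_(k2 < q.+1) T_cw R q (i2, j2, k2) *
  \sum_(Q < 10) wedge_mx _ (color i0 i1 i2) P Q * phi k0 k1 k2 Q = 0.
Proof.
have := congr1 (fun M : 'cV_ _ => M (enum_rank ((j0, (j1, (j2, tt))), P)) 0) kerPhi.
rewrite !mxE (reindex (@enum_rank E)) /=; last first.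
  exact: onW_bij (enum_rank_bij E).
under eq_bigr do rewrite mxE !enum_rankK /=.
move=> ker0; rewrite -[RHS]ker0 {ker0}.
pose T := kron_pow (T_cw R q) 3%N.
pose G (i k : I3) := \sum_(Q < 10) color_mx i P Q * Phi (enum_rank (k, Q)) 0.
transitivity (\sum_i \sum_k T (i, (j0, (j1, (j2, tt))), k) * G i k); last first.
  rewrite exchange_big /=.
  transitivity (\sum_k \sum_(Q < 10) (\sum_i T (i, (j0, (j1, (j2, tt))), k) * color_mx i P Q) * Phi (enum_rank (k, Q)) 0).
    apply: eq_bigr => k _; under [RHS]eq_bigr do rewrite mulr_suml.
    rewrite [RHS]exchange_big; apply: eq_bigr => i _.
    by rewrite /G mulr_sumr; apply: eq_bigr => Q _; rewrite mulrA.
  by rewrite pair_bigA; apply: eq_bigr => -[k Q] _.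
rewrite sum_I3; apply: eq_bigr => i0 _.
under [RHS]eq_bigr do under eq_bigr do rewrite sum_I3.
under [RHS]eq_bigr do rewrite exchange_big.
rewrite [RHS]exchange_big; apply: eq_bigr => k0 _; rewrite mulr_sumr.
apply: eq_bigr => i1 _.
rewrite [RHS]exchange_big mulr_sumr; apply: eq_bigr => k1 _ /=.
rewrite !mulr_sumr; apply: eq_bigr => i2 _.
rewrite !mulr_sumr; apply: eq_bigr => k2 _.
rewrite /T !ffunE /= mulr1 -!mulrA; congr (_ * (_ * (_ * _))).
by apply: eq_bigr => Q _; rewrite /phi /idx3 !inord_val.
Qed.

Let psi m0 m1 m2 (c : positive) := Phi (enum_rank (pos m0 m1 m2 c)) 0.

(** This is the kernel equation at the b-indices [emb m b]: color 5 kills every a-index above 5, so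
    [cw_slice] applies to each factor in turn. *)
Lemma koszul_row_killed m0 m1 m2 b0 b1 b2 P :
    (m0 + 5 <= q)%N -> (m1 + 5 <= q)%N -> (m2 + 5 <= q)%N ->
    (b0 < if m0 == 0 then 6 else 1)%N -> (b1 < if m1 == 0 then 6 else 1)%N ->
    (b2 < if m2 == 0 then 6 else 1)%N -> (P < 10)%N ->
  seval (psi m0 m1 m2) (koszul_row (m0 == 0) (m1 == 0) (m2 == 0) b0 b1 b2 P)%N = 0.
Proof.
move=> hm0 hm1 hm2 hb0 hb1 hb2 P10.
rewrite -(koszul_flat_ker (inord (emb m0 b0)) (inord (emb m1 b1)) (inord (emb m2 b2)) (Ordinal P10)).
have out i0 i1 i2 k0 k1 k2 : [|| 5 < i0, 5 < i1 | 5 < i2]%N ->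
    \sum_(Q < 10) wedge_mx R[i] (color i0 i1 i2) (Ordinal P10) Q * phi k0 k1 k2 Q = 0.
  by move=> /color_out ->; rewrite wedge_mx_out // big1 // => Q _; rewrite mxE mul0r.
rewrite (@cw_slice R q m0 b0 (fun i0 k0 =>
  \sum_(i1 < q.+1) \sum_(k1 < q.+1) T_cw R q (i1, inord (emb m1 b1), k1) *
  \sum_(i2 < q.+1) \sum_(k2 < q.+1) T_cw R q (i2, inord (emb m2 b2), k2) *
  \sum_(Q < 10) wedge_mx _ (color i0 i1 i2) (Ordinal P10) Q * phi k0 k1 k2 Q)) //; last first.
  move=> i0 k0 i05; rewrite big1 // => i1 _; rewrite big1 // => k1 _.
  rewrite big1 ?mulr0 // => i2 _; rewrite big1 // => k2 _.
  by rewrite out ?mulr0 // i05.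
rewrite seval_koszul_row big_seq [RHS]big_seq; apply: eq_bigr => p0 p0n.
rewrite (@cw_slice R q m1 b1 (fun i1 k1 =>
  \sum_(i2 < q.+1) \sum_(k2 < q.+1) T_cw R q (i2, inord (emb m2 b2), k2) *
  \sum_(Q < 10) wedge_mx _ (color p0.2 i1 i2) (Ordinal P10) Q * phi (emb m0 p0.1) k1 k2 Q)) //; last first.
  move=> i1 k1 i15; rewrite big1 // => i2 _; rewrite big1 // => k2 _.
  by rewrite out ?mulr0 // i15 orbT.
rewrite big_seq [RHS]big_seq; apply: eq_bigr => p1 p1n.
rewrite (@cw_slice R q m2 b2 (fun i2 k2 =>
  \sum_(Q < 10) wedge_mx _ (color p0.2 p1.2 i2) (Ordinal P10) Q *
    phi (emb m0 p0.1) (emb m1 p1.1) k2 Q)) //; last first.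
  by move=> i2 k2 i25; rewrite out // i25 !orbT.
rewrite big_seq [RHS]big_seq; apply: eq_bigr => p2 p2n.
transitivity (\sum_(w <- wedge (color p0.2 p1.2 p2.2) P)
   Zinj R[i] w.2 * phi (emb m0 p0.1) (emb m1 p1.1) (emb m2 p2.1) w.1).
  rewrite big_seq [RHS]big_seq; apply: eq_bigr => w /wedge_lt w10.
  by rewrite /psi /pos dec_enc // ?(nbr_lt hb0 p0n) ?(nbr_lt hb1 p1n) ?(nbr_lt hb2 p2n).
rewrite (@sum_coef_at _ 10) => [|w]; last exact: wedge_lt.
by apply: eq_bigr => Q _; rewrite mxE.
Qed.

Lemma koszul_pivots_killed m0 m1 m2 :
    (m0 + 5 <= q)%N -> (m1 + 5 <= q)%N -> (m2 + 5 <= q)%N ->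
  kills (psi m0 m1 m2) (koszul_pivots (m0 == 0) (m1 == 0) (m2 == 0))%N.
Proof.
move=> hm0 hm1 hm2; apply: kills_echelon; rewrite all_sort /koszul_rows /rng (lock (iota 0 10)).
rewrite all_flatten all_map; apply/allP => b0; rewrite mem_iota => /= hb0.
rewrite all_flatten all_map; apply/allP => b1; rewrite mem_iota => /= hb1.
rewrite all_flatten all_map; apply/allP => b2; rewrite mem_iota => /= hb2.
rewrite all_map; apply/allP => P; rewrite -lock => hP.
have {}hP : (P < 10)%N by move: hP; rewrite -[X in P \in X]/(iota 0 10) mem_iota.
by rewrite /= koszul_row_killed.
Qed.

End Kernel.

(** * Disjointness of the blocks and the number of pivots *)

Lemma idx3_inj k0 k1 k2 Q k0' k1' k2' Q' :
  [&& k0 <= q, k1 <= q, k2 <= q & Q < 10]%N ->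
  [&& k0' <= q, k1' <= q, k2' <= q & Q' < 10]%N ->
  idx3 k0 k1 k2 Q = idx3 k0' k1' k2' Q' -> [/\ k0 = k0', k1 = k1', k2 = k2' & Q = Q'].
Proof.
move=> /and4P[h0 h1 h2 hQ] /and4P[h0' h1' h2' hQ'].
move=> [/(congr1 val) e0 /(congr1 val) e1 /(congr1 val) e2 /(congr1 val) eQ].
by move: e0 e1 e2 eQ; rewrite /= !inordK.
Qed.

Lemma emb_inj m g m' g' :
  (g < if m == 0 then 6 else 1)%N -> (g' < if m' == 0 then 6 else 1)%N ->
  emb m g = emb m' g' -> m = m' /\ g = g'.
Proof. by rewrite /emb; do 2!case: eqP => ?; lia. Qed.

Lemma emb_le m g :
  (m + 5 <= q)%N -> (g < if m == 0 then 6 else 1)%N -> (emb m g <= q)%N.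
Proof. by rewrite /emb; case: eqP => ?; lia. Qed.

(** Different blocks occupy disjoint sets of columns, as [emb] keeps inner indices at most 5 and
    outer ones above 5. *)
Lemma pos_inj m0 m1 m2 c m0' m1' m2' c' :
    [&& m0 + 5 <= q, m1 + 5 <= q & m2 + 5 <= q]%N ->
    [&& m0' + 5 <= q, m1' + 5 <= q & m2' + 5 <= q]%N ->
    valid (m0 == 0)%N (m1 == 0)%N (m2 == 0)%N c ->
    valid (m0' == 0)%N (m1' == 0)%N (m2' == 0)%N c' ->
  pos m0 m1 m2 c = pos m0' m1' m2' c' ->
  [/\ m0 = m0', m1 = m1', m2 = m2' & c = c'].
Proof.
move=> /and3P[h0 h1 h2] /and3P[h0' h1' h2'].
rewrite /valid /pos; case: (dec c) => [[[g0 g1] g2] Q].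
case: (dec c') => [[[g0' g1'] g2'] Q'].
move=> /and5P[/Pos.eqb_spec <- v0 v1 v2 vQ] /and5P[/Pos.eqb_spec <- v0' v1' v2' vQ'].
move=> /idx3_inj[]; rewrite ?emb_le ?vQ ?vQ' //.
move=> /(emb_inj v0 v0')[-> ->] /(emb_inj v1 v1')[-> ->].
by move=> /(emb_inj v2 v2')[-> ->] ->.
Qed.

(* Pivots of all blocks: the first three components choose the block. *)
Let D0 : finType := ('I_o.+1 * 'I_o.+1 * 'I_o.+1 * 'I_2160)%type.
Definition dpiv (d : D0) : pivots :=
  (koszul_pivots (d.1.1.1 == 0 :> nat) (d.1.1.2 == 0 :> nat)
                 (d.1.2 == 0 :> nat))%N.
Definition dgood (d : D0) : bool :=
  (good_pivot (d.1.1.1 == 0 :> nat) (d.1.1.2 == 0 :> nat)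
              (d.1.2 == 0 :> nat) (dpiv d) d.2)%N.
Definition dcode (d : D0) : positive := Pos.of_succ_nat d.2.
Definition drow (d : D0) : svec :=
  odflt [::] (FMapPositive.PositiveMap.find (dcode d) (dpiv d)).
Definition dpos (d : D0) (c : positive) : E := pos d.1.1.1 d.1.1.2 d.1.2 c.
Definition dvec (d : D0) (e : E) : R[i] :=
  \sum_(w <- drow d) Zinj R[i] w.2 * (e == dpos d w.1)%:R.
Definition dvalid (d : D0) (c : positive) : bool :=
  (valid (d.1.1.1 == 0 :> nat) (d.1.1.2 == 0 :> nat) (d.1.2 == 0 :> nat) c)%N.

Lemma dgoodP d : dgood d -> exists y u,
  [/\ drow d = (dcode d, y) :: u, ~~ Z.eqb y Z0, dvalid d (dcode d),
     all (fun e => Pos.ltb (dcode d) e.1) u & all (fun e => dvalid d e.1) u].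
Proof.
rewrite /dgood /good_pivot /drow -/(dcode d).
case: FMapPositive.PositiveMap.find => [[|[c y] u]|] //=.
by move=> /and5P[/Pos.eqb_spec -> ? ? ? ?]; exists y, u.
Qed.

Lemma m_le (m : 'I_o.+1) : (m + 5 <= q)%N.
Proof. by have := ltn_ord m; rewrite /o; lia. Qed.

Lemma dpos_inj d d' c c' : dvalid d c -> dvalid d' c' ->
  dpos d c = dpos d' c' -> d.1 = d'.1 /\ c = c'.
Proof.
move=> dc dc' /pos_inj[]; rewrite ?m_le //.
move: d d' {dc dc'} => [[[m0 m1] m2] n] [[[m0' m1'] m2'] n'] /=.
by move=> /val_inj -> /val_inj -> /val_inj -> ->.
Qed.

Lemma dcode_inj (d d' : D0) : d.1 = d'.1 -> dcode d = dcode d' -> d = d'.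
Proof.
move: d d' => [m n] [m' n'] /= ->; rewrite /dcode /= => e; congr (_, _).
by apply/val_inj => /=; lia.
Qed.

Lemma dvec_lead d : dgood d -> dvec d (dpos d (dcode d)) != 0.
Proof.
move=> /dgoodP[y [u [e y0 v lt vu]]]; rewrite /dvec e big_cons eqxx mulr1.
rewrite big_seq big1 ?addr0 ?Zinj_neq0 // => w wu.
case: eqP => [/dpos_inj|_]; last by rewrite mulr0.
move=> [//||_ ew]; first by have := allP vu w wu.
by have := allP lt w wu; rewrite -ew Pos.ltb_irrefl.
Qed.

(** A common column forces the same block. The leading code of [d] then occurs in the row of [d'],
    either as its leading code, whence d' = d, or after it. *)
Lemma dvec_supp d d' : dgood d -> dgood d' -> dvec d' (dpos d (dcode d)) != 0 ->
  d' = d \/ (d'.2 < d.2)%N.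
Proof.
move=> /dgoodP[y [u [_ _ v _ _]]] /dgoodP[y' [u' [e' _ v' lt' vu']]] ne0.
have [w wu /eqP we] : exists2 w, w \in drow d' & dpos d (dcode d) == dpos d' w.1.
  apply/hasP; apply: contraNT ne0 => /hasPn h; rewrite /dvec big_seq big1 // => w wu.
  by rewrite (negPf (h _ wu)) mulr0.
move: wu; rewrite e' inE => /orP[/eqP ew|wu].
  move: we; rewrite ew /= => /dpos_inj[] // em ec; left; exact/esym/dcode_inj.
have [em ec] := dpos_inj v (allP vu' w wu) we.
right; apply: of_succ_nat_lt; apply/Pos.ltb_lt.
by rewrite -/(dcode d) ec; exact: (allP lt' w wu).
Qed.

Lemma koszul_flat_dvec (Phi : 'cV[R[i]]_#|E|) d : koszul_flat *m Phi = 0 ->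
  \sum_e dvec d e * Phi (enum_rank e) 0 = 0.
Proof.
move=> ker0.
transitivity (seval (fun c => Phi (enum_rank (dpos d c)) 0) (drow d)).
  rewrite /seval /dvec; under eq_bigr do rewrite mulr_suml.
  rewrite exchange_big; apply: eq_bigr => w _.
  rewrite (bigD1 (dpos d w.1)) //= eqxx mulr1 big1 ?addr0 // => e /negPf ->.
  by rewrite mulr0 mul0r.
rewrite /drow; case e: FMapPositive.PositiveMap.find => [u|] /=; last first.
  by rewrite /seval big_nil.
by apply: (@koszul_pivots_killed Phi ker0 _ _ _ _ _ _ _ _ e); apply: m_le.
Qed.

Let D : finType := {d : D0 | dgood d}.

(** By the product form of [pivot_countE] the triple sum over blocks is 6 times the cube of the sum
    of [w], which is 7 + (q - 5). *)
Lemma card_D : #|D| = (6 * (q + 2) ^ 3)%N.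
Proof.
pose w (m : 'I_o.+1) := if m == 0 :> nat then 7 else 1%N.
have w_sum : (\sum_m w m = q + 2)%N.
  rewrite big_ord_recl /w /= sum1_card card_ord /o; lia.
rewrite card_sig -sum1_card.
transitivity (\sum_(m0 < o.+1) \sum_(m1 < o.+1) \sum_(m2 < o.+1)
   \sum_(n < 2160 | dgood (m0, m1, m2, n)) 1)%N.
  rewrite big_mkcond; under [RHS]eq_bigr do under eq_bigr do under eq_bigr do rewrite big_mkcond.
  by rewrite !pair_bigA; apply: eq_bigr => -[[[]]].
transitivity (\sum_(m0 < o.+1) \sum_(m1 < o.+1) \sum_(m2 < o.+1)
   6 * (w m0 * (w m1 * w m2)))%N.
  apply: eq_bigr => m0 _; apply: eq_bigr => m1 _; apply: eq_bigr => m2 _.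
  rewrite sum1_card.
  transitivity (pivot_count (m0 == 0 :> nat) (m1 == 0 :> nat) (m2 == 0 :> nat))%N.
    by rewrite /pivot_count -val_enum_ord count_map cardE size_filter enumT.
  by rewrite pivot_countE.
under eq_bigr do under eq_bigr do rewrite -!big_distrr /=.
under eq_bigr do rewrite -!big_distrr -big_distrl /=.
by rewrite -big_distrr -big_distrl /= w_sum; lia.
Qed.

Lemma koszul_flat_rank : (6 * (q + 2) ^ 3 <= \rank koszul_flat)%N.
Proof.
rewrite -card_D.
apply: (@echelon_rank R[i] D E _ koszul_flat (fun d => dvec (val d))
   (fun d => dpos (val d) (dcode (val d))) (fun d => (val d).2)).
- by move=> d; apply/dvec_lead/valP.
- by move=> d d' /dvec_supp[]; [exact: valP|exact: valP|move/val_inj; left|right].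
- by move=> Phi ker0 d; apply: koszul_flat_dvec.
Qed.

End LowerBound.

Local Close Scope complex_scope.
Local Close Scope ring_scope.

Theorem theorem2p2 (R : realType) (q : nat) (hq : (4 < q)%N) :
  border_rank (kron_pow (T_cw R q) 3) = ((q + 2) ^ 3)%N.
Proof.
rewrite /border_rank; case: ex_minnP => r /asboolP Tr rmin.
apply/eqP; rewrite eqn_leq; apply/andP; split.
  apply: rmin; apply/asboolP; apply: limit_of_rank_sums_kron_pow; exact: T_cw_limit.
(* The flattening has rank at least 6 (q + 2)^3 and, by semicontinuity, at most 6 r. *)
rewrite -(leq_pmul2l (m := 6)) //; apply: leq_trans (koszul_flat_rank R hq) _.
by apply: flat_limit Tr => a; apply: color_mx_rank.
Qed.
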